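(* Let $l\in F$ be a failed link. Suppose there exists a hyper-node $U$ with $l\in E_U$ such that: 1. $\tilde D_{U,e}\tilde D_{U,e'}>0$ for all $e,e'\in E_U\cap F$; 2. $S_U=\emptyset$; 3. $f_{U,g}+(\eta-1)|\tilde D_{U,l}|<0$. Then $l$ is detected by the Failed Link Detection algorithm with threshold $\eta$, i.e. $l\in\hat F$.
   Context: Let $G=(V,E)$ be a finite connected simple undirected graph (the power grid); each link $(s,t)\in E$ has a reactance $r_{st}=r_{ts}\neq 0$. The admittance matrix $B=(b_{uv})_{u,v\in V}$ of $G$ has $b_{uv}=-1/r_{uv}$ if $u\ne v$ and $(u,v)\in E$, $b_{uv}=0$ if $u\neq v$ and $(u,v)\notin E$, and $b_{uu}=-\sum_{w\in V\setminus\{u\}}b_{uw}$. Before the attack, the phase angles $\theta\in\mathbb R^V$ and active power injections $p\in\mathbb R^V$ satisfy $B\theta=p$. The attacked area $H=(V_H,E_H)$ is the subgraph of $G$ induced by $V_H\subseteq V$; the attack disconnects a nonempty set $F\subseteq E_H$ of links. After the attack, $\theta',p'\in\mathbb R^V$ satisfy $B'\theta'=p'$, where $B'$ is the admittance matrix of $(V,E\setminus F)$ with the same reactances. Put $\Delta^*:=p-p'$ (ground-truth change of injections). Standing assumptions: $\theta'_s\neq\theta'_t$ for every $(s,t)\in E_H$; and for every $v\in V_H$, $0\le\Delta^*_v\le p_v$ if $p_v>0$ and $p_v\le\Delta^*_v\le 0$ if $p_v\le 0$. For $u\in V_H$ and $e\in E_H$, let $\tilde D_{u,e}:=(\theta'_u-\theta'_v)/r_{uv}$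 if $e=(u,v)$ is incident to $u$, and $\tilde D_{u,e}:=0$ otherwise. Failed Link Detection algorithm with threshold $\eta\in(0,1)$: take an optimal solution $(x,\delta)$, $x\in\mathbb R^{E_H}$, $\delta\in\mathbb R^{V_H}$, of the linear program: minimize $\sum_{e\in E_H}x_e$ subject to $\delta_v=(B(\theta-\theta'))_v+\sum_{e\in E_H}\tilde D_{v,e}x_e$ for all $v\in V_H$; $0\le\delta_v\le p_v$ for $v\in V_H$ with $p_v>0$; $p_v\le\delta_v\le0$ for $v\in V_H$ with $p_v\le0$; $0\le x_e\le1$ for all $e\in E_H$. Return $\hat F:=\{e\in E_H: x_e\ge\eta\}$. For $u\in V_H$: if $p_u\le 0$, $g_{D,u}:=-\Delta^*_u$ and $g_{D,-u}:=-p'_u$; if $p_u>0$, $g_{D,u}:=p'_u$ and $g_{D,-u}:=\Delta^*_u$. A hyper-node is a set $U\subseteq V_H$ of nodes that induces a connected subgraph before the attack. $E_U$ is the set of links in $E_H$ with exactly one endpoint in $U$. $\tilde D_{U,e}:=\sum_{u\in U}\tilde D_{u,e}$. If $E_U\cap F\ne\emptyset$: $S_U:=\{e\in E_U\setminus F:\exists l\in E_U\cap F,\ \tilde D_{U,l}\tilde D_{U,e}>0\}$, and $f_{U,g}:=\sum_{u\in U}g_{D,u}$ if there is $l\in E_U\cap F$ with $\tilde D_{U,l}<0$, and $f_{U,g}:=\sum_{u\in U}g_{D,-u}$ otherwise. *)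

(* Defs.v *)
From HB Require Import structures.
From mathcomp Require Import all_boot all_order all_algebra.
From mathcomp Require Import reals.

Set Implicit Arguments.
Unset Strict Implicit.
Unset Printing Implicit Defensive.

Import Order.TTheory GRing.Theory Num.Theory.
Local Open Scope ring_scope.

(* A simple undirected graph on the finite vertex type V is given by its set  *)
(* of links E : {set {set V}}, a link (s, t) being the pair [set s; t].       *)
(* Reactances r : V -> V -> R only matter on pairs of adjacent vertices.      *)
(* Elements of R^V are functions V -> R.                                      *)

Definition simple_graph (V : finType) (E : {set {set V}}) : Prop :=
  forall e, e \in E -> #|e| = 2%N.

Definition induced_links (V : finType) (E : {set {set V}}) (A : {set V}) :
    {set {set V}} :=
  [set e in E | e \subset A].

Definition induces_connected (V : finType) (E : {set {set V}}) (A : {set V}) :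
    Prop :=
  A != set0 /\
  {in A &, forall u v,
     connect [rel x y | [set x; y] \in induced_links E A] u v}.

Definition reactance (R : realType) (V : finType) (E : {set {set V}})
    (r : V -> V -> R) : Prop :=
  forall s t, [set s; t] \in E -> r s t = r t s /\ r s t != 0.

Definition admittance_offdiag (R : realType) (V : finType)
    (E : {set {set V}}) (r : V -> V -> R) (u v : V) : R :=
  if [set u; v] \in E then - (1 / r u v) else 0.

Definition admittance (R : realType) (V : finType)
    (E : {set {set V}}) (r : V -> V -> R) (u v : V) : R :=
  if u == v then - \sum_(w | w != u) admittance_offdiag E r u w
  else admittance_offdiag E r u v.

Definition mulmv (R : realType) (V : finType)
    (B : V -> V -> R) (y : V -> R) (u : V) : R :=
  \sum_v B u v * y v.

(* Used both with q = injection_change p p' (the standing assumption on the   *)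
(* attack) and with q = delta (the constraint of the linear program).         *)
Definition within_injection (R : realType) (V : finType) (VH : {set V})
    (p q : V -> R) : Prop :=
  forall v, v \in VH ->
    (0 < p v -> 0 <= q v <= p v) /\ (p v <= 0 -> p v <= q v <= 0).

(* \tilde D_{u,e}: for e = [set u; v] with u != v the sum has the single term *)
(* indexed by v, and it is empty when u is not an endpoint of e.              *)
Definition Dt (R : realType) (V : finType) (r : V -> V -> R) (theta' : V -> R)
    (u : V) (e : {set V}) : R :=
  \sum_(v | e == [set u; v]) (theta' u - theta' v) / r u v.

(* x and delta range over total functions, but only their values on the links *)
(* of H and on VH respectively are constrained or used.                       *)
Definition FLD_feasible (R : realType) (V : finType)
    (E : {set {set V}}) (r : V -> V -> R) (VH : {set V})
    (p theta theta' : V -> R) (x : {set V} -> R) (delta : V -> R) : Prop :=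
  [/\ forall v, v \in VH ->
        delta v = mulmv (admittance E r) (fun w => theta w - theta' w) v
                  + \sum_(e in induced_links E VH) Dt r theta' v e * x e,
      within_injection VH p delta
    & forall e, e \in induced_links E VH -> 0 <= x e <= 1].

Definition FLD_optimal (R : realType) (V : finType)
    (E : {set {set V}}) (r : V -> V -> R) (VH : {set V})
    (p theta theta' : V -> R) (x : {set V} -> R) (delta : V -> R) : Prop :=
  FLD_feasible E r VH p theta theta' x delta /\
  forall y eps, FLD_feasible E r VH p theta theta' y eps ->
    \sum_(e in induced_links E VH) x e <= \sum_(e in induced_links E VH) y e.

Definition FLD_output (R : realType) (V : finType) (E : {set {set V}})
    (VH : {set V}) (eta : R) (x : {set V} -> R) : {set {set V}} :=
  [set e in induced_links E VH | eta <= x e].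

Definition hyper_node (V : finType) (E : {set {set V}}) (VH U : {set V}) :
    Prop :=
  U \subset VH /\ induces_connected E U.

Definition boundary_links (V : finType) (E : {set {set V}}) (VH U : {set V}) :
    {set {set V}} :=
  [set e in induced_links E VH | #|e :&: U| == 1%N].

Definition DtU (R : realType) (V : finType) (r : V -> V -> R)
    (theta' : V -> R) (U : {set V}) (e : {set V}) : R :=
  \sum_(u in U) Dt r theta' u e.

Definition injection_change (R : realType) (V : finType) (p p' : V -> R)
    (v : V) : R := p v - p' v.

Definition gD (R : realType) (V : finType) (p p' : V -> R) (u : V) : R :=
  if p u <= 0 then - injection_change p p' u else p' u.

Definition gD_neg (R : realType) (V : finType) (p p' : V -> R) (u : V) : R :=
  if p u <= 0 then - p' u else injection_change p p' u.

Definition SU (R : realType) (V : finType) (E : {set {set V}})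
    (r : V -> V -> R) (VH : {set V}) (F : {set {set V}}) (theta' : V -> R)
    (U : {set V}) : {set {set V}} :=
  [set e in boundary_links E VH U :\: F |
     [exists l in boundary_links E VH U :&: F,
        0 < DtU r theta' U l * DtU r theta' U e]].

(* Only meaningful when boundary_links E VH U meets F. *)
Definition fUg (R : realType) (V : finType) (E : {set {set V}})
    (r : V -> V -> R) (VH : {set V}) (F : {set {set V}})
    (p p' theta' : V -> R) (U : {set V}) : R :=
  if [exists l in boundary_links E VH U :&: F, DtU r theta' U l < 0]
  then \sum_(u in U) gD p p' u
  else \sum_(u in U) gD_neg p p' u.

(* Main.v *)
Require Import Defs.
From HB Require Import structures.
From mathcomp Require Import all_boot all_order all_algebra.
From mathcomp Require Import reals ring lra.

Set Implicit Arguments.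
Unset Strict Implicit.
Unset Printing Implicit Defensive.

Import Order.TTheory GRing.Theory Num.Theory.
Local Open Scope ring_scope.

(** Subtracting the flow equations before and after the attack shows that
    every LP-feasible pair satisfies, at each node of H,
      delta - Delta^* = sum_e Dt_e (x_e - [e \in F]).
    Summed over the hyper-node U, interior links cancel and only the links of
    E_U remain. By conditions 1 and 2, each remaining term has sign opposite
    to that of Dt_{U,l}, so the left-hand side is at least
    (1 - x_l) |Dt_{U,l}| in absolute value, whereas the injection bounds make
    it at most f_{U,g}; with condition 3 this forces x_l >= eta. *)

Lemma Dt_notin (R : realType) (V : finType) (r : V -> V -> R) (y : V -> R)
    (u : V) (e : {set V}) :
  u \notin e -> Dt r y u e = 0.
Proof.
move=> une; rewrite /Dt big_pred0 // => v; apply: contraNF une => /eqP ->.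
by rewrite set21.
Qed.

Lemma Dt_set2 (R : realType) (V : finType) (r : V -> V -> R) (y : V -> R)
    (s t : V) :
  s != t -> Dt r y s [set s; t] = (y s - y t) / r s t.
Proof.
move=> st; rewrite /Dt (big_pred1 t) // => v /=; apply/eqP/eqP => [|-> //].
move=> /setP/(_ t); rewrite set22 !inE eq_sym (negPf st) /=.
by move/esym/eqP.
Qed.

(** The admittance matrix is a weighted Laplacian: its zero row sums turn [y v] into the differences
    [y u - y v]. Written as a sum over links, the products for [E] and for [E :\: F] can be compared
    link by link. *)
Lemma mulmv_admittance (R : realType) (V : finType) (E : {set {set V}})
    (r : V -> V -> R) (y : V -> R) (u : V) :
  mulmv (admittance E r) y u = \sum_(e in E) Dt r y u e.
Proof.
have -> : \sum_(e in E) Dt r y u e =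
    \sum_v (if [set u; v] \in E then (y u - y v) / r u v else 0).
  rewrite /Dt (exchange_big_dep xpredT) //=; apply: eq_bigr => v _.
  case: ifPn => [uvE|uvNE].
    rewrite (big_pred1 [set u; v]) // => e /=.
    by case: eqP => [->|]; rewrite ?uvE ?andbF.
  by rewrite big_pred0 // => e; case: eqP => [->|]; rewrite ?(negPf uvNE) ?andbF.
(* The index [u] carries the diagonal entry on the left, and a zero difference on the right in
   either branch of the [if]. *)
rewrite /mulmv (bigD1 u) //= [RHS](bigD1 u) //= subrr mul0r if_same add0r.
rewrite /admittance eqxx mulNr mulr_suml -sumrN -big_split /=.
apply: eq_bigr => v vu; rewrite eq_sym (negPf vu) /admittance_offdiag.
by case: ifP => _; ring.
Qed.

(** With both endpoints in [U], the two contributions are opposite because [r] is symmetric on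
    links; with none, every contribution is zero. *)
Lemma DtU_eq0 (R : realType) (V : finType) (E : {set {set V}})
    (r : V -> V -> R) (y : V -> R) (U e : {set V}) :
  simple_graph E -> reactance E r -> e \in E -> #|e :&: U| != 1%N ->
  DtU r y U e = 0.
Proof.
move=> graphE reactE eE; have /eqP/cards2P[s [t [st e_st]]] := graphE e eE.
subst e; have [rst _] := reactE _ _ eE.
have [sU|sU] := boolP (s \in U); have [tU|tU] := boolP (t \in U).
- move=> _; rewrite /DtU (bigD1 s) //= (bigD1 t) ?tU 1?eq_sym //=.
  rewrite big1 ?addr0 => [|u /andP[/andP[_ us] ut]]; last first.
    by rewrite Dt_notin // !inE negb_or us ut.
  rewrite Dt_set2 // setUC Dt_set2 1?eq_sym // rst; ring.
- suff -> : [set s; t] :&: U = [set s] by rewrite cards1.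
  apply/setP => u; rewrite !inE.
  by case: eqP => [->|_] //=; case: eqP => [->|_]; rewrite ?(negPf tU).
- suff -> : [set s; t] :&: U = [set t] by rewrite cards1.
  apply/setP => u; rewrite !inE.
  case: (u =P t) => [->|_]; first by rewrite orbT.
  by case: eqP => [->|_] //=; rewrite ?(negPf sU).
- move=> _; rewrite /DtU big1 // => u uU; apply: Dt_notin.
  by rewrite !inE negb_or; apply/andP; split; apply: contraTN uU => /eqP->.
Qed.

(** The true attack is the 0-1 indicator of [F]: since B theta' exceeds p' by the flows on [F], B
    (theta - theta') is the true change minus those flows. The identity measures any feasible pair
    against it. *)
Lemma FLD_feasible_change (R : realType) (V : finType) (E : {set {set V}})
    (r : V -> V -> R) (VH : {set V}) (F : {set {set V}})
    (theta p theta' p' : V -> R) (x : {set V} -> R) (delta : V -> R) (v : V) :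
  (forall v, mulmv (admittance E r) theta v = p v) ->
  F \subset induced_links E VH ->
  (forall v, mulmv (admittance (E :\: F) r) theta' v = p' v) ->
  FLD_feasible E r VH p theta theta' x delta -> v \in VH ->
  delta v - injection_change p p' v =
    \sum_(e in induced_links E VH) Dt r theta' v e * (x e - (e \in F)%:R).
Proof.
move=> pre Fsub post [xdelta _ _] vH; rewrite xdelta //.
have FE : F \subset E.
  by apply: subset_trans Fsub _; apply/subsetP => e; rewrite inE => /andP[].
have -> : mulmv (admittance E r) (fun w => theta w - theta' w) v =
    p v - mulmv (admittance E r) theta' v.
  by rewrite -pre /mulmv -sumrB; apply: eq_bigr => w _; rewrite mulrBr.
under [RHS]eq_bigr do rewrite mulrBr; rewrite sumrB /=.
have -> : \sum_(e in induced_links E VH) Dt r theta' v e * (e \in F)%:R =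
    \sum_(e in F) Dt r theta' v e.
  rewrite (big_setID F) /= (setIidPr Fsub) [X in _ + X]big1 ?addr0 => [|e].
    by apply: eq_bigr => e ->; rewrite mulr1.
  by rewrite inE => /andP[/negPf-> _]; rewrite mulr0.
rewrite /injection_change -post !mulmv_admittance.
by rewrite [\sum_(e in E) _](big_setID F) /= (setIidPr FE); ring.
Qed.

Lemma sum_hyper_node_change (R : realType) (V : finType)
    (E : {set {set V}}) (r : V -> V -> R) (VH U : {set V}) (y : V -> R)
    (q : V -> R) (z : {set V} -> R) :
  simple_graph E -> reactance E r -> U \subset VH ->
  (forall v, v \in VH ->
     q v = \sum_(e in induced_links E VH) Dt r y v e * z e) ->
  \sum_(u in U) q u = \sum_(e in boundary_links E VH U) DtU r y U e * z e.
Proof.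
move=> graphE reactE /subsetP UH qE.
rewrite (eq_bigr _ (fun u uU => qE u (UH u uU))) exchange_big /=.
under eq_bigr do rewrite -mulr_suml -/(DtU r y U _).
rewrite (bigID (fun e : {set V} => #|e :&: U| == 1%N)) /=.
rewrite [X in _ + X]big1 ?addr0 => [|e].
  by apply: eq_bigl => e; rewrite [RHS]inE.
rewrite inE => /andP[/andP[eE _] eU].
by rewrite (DtU_eq0 y graphE reactE eE eU) mul0r.
Qed.

(** The admissible interval at [u] runs between 0 and [p u]. Measured from the true change, [gD] is
    the distance to its upper end and [gD_neg] the distance to its lower end. *)
Lemma sum_change_bounds (R : realType) (V : finType) (VH U : {set V})
    (p p' delta : V -> R) :
  U \subset VH -> within_injection VH p delta ->
  - (\sum_(u in U) gD_neg p p' u)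
    <= \sum_(u in U) (delta u - injection_change p p' u)
    <= \sum_(u in U) gD p p' u.
Proof.
move=> /subsetP UH bnd; rewrite -sumrN.
apply/andP; split; apply: ler_sum => u /UH/bnd[pos neg];
  rewrite /gD /gD_neg /injection_change; case: (lerP (p u) 0).
- by move=> /neg/andP[]; lra.
- by move=> /pos/andP[]; lra.
- by move=> /neg/andP[]; lra.
- by move=> /pos/andP[]; lra.
Qed.

Theorem theoremV1 (R : realType) (V : finType)
    (E : {set {set V}}) (r : V -> V -> R)
    (VH : {set V}) (F : {set {set V}})
    (theta p theta' p' : V -> R) (eta : R)
    (x : {set V} -> R) (delta : V -> R) (l : {set V})
    (graphE : simple_graph E)
    (connE : induces_connected E [set: V])
    (reactE : reactance E r)
    (pre_attack : forall v, mulmv (admittance E r) theta v = p v)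
    (F_neq0 : F != set0)
    (F_sub : F \subset induced_links E VH)
    (post_attack : forall v,
       mulmv (admittance (E :\: F) r) theta' v = p' v)
    (theta'_neq : forall s t,
       [set s; t] \in induced_links E VH -> theta' s != theta' t)
    (change_bounds : within_injection VH p (injection_change p p'))
    (eta_bounds : 0 < eta < 1)
    (opt : FLD_optimal E r VH p theta theta' x delta)
    (lF : l \in F) :
  (exists U : {set V},
     [/\ hyper_node E VH U,
         l \in boundary_links E VH U,
         forall e e', e \in boundary_links E VH U :&: F ->
           e' \in boundary_links E VH U :&: F ->
           0 < DtU r theta' U e * DtU r theta' U e',
         SU E r VH F theta' U = set0
       & fUg E r VH F p p' theta' U
           + (eta - 1) * `|DtU r theta' U l| < 0]) ->
  l \in FLD_output E VH eta x.
Proof.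
case=> U [[UH _] lU same_sign SU0 fU_lt].
have [feas _] := opt; have [_ delta_bnd x01] := feas.
have lH := subsetP F_sub l lF.
rewrite inE lH /= leNgt; apply/negP => xl_lt.
pose d := DtU r theta' U.
have lUF : l \in boundary_links E VH U :&: F by rewrite inE lU lF.
have dl2 : 0 < d l * d l by apply: same_sign.
pose D := \sum_(u in U) (delta u - injection_change p p' u).
have DE : D =
    \sum_(e in boundary_links E VH U) d e * (x e - (e \in F)%:R).
  apply: sum_hyper_node_change => // v.
  exact: FLD_feasible_change pre_attack F_sub post_attack feas.
(* Multiplying by [d l] treats both signs of [d l] at once: every term other than that of [l]
   becomes nonpositive. *)
have D_le : d l * D <= d l * (d l * (x l - 1)).
  rewrite DE (bigD1 l) //= lF mulrDr gerDl mulr_sumr.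
  apply: sumr_le0 => e /andP[eU _].
  have /x01/andP[xe0 xe1] : e \in induced_links E VH.
    by move: eU; rewrite inE => /andP[].
  rewrite mulrA; have [eF|eF] := boolP (e \in F).
    have eUF : e \in boundary_links E VH U :&: F by rewrite inE eU eF.
    by apply: mulr_ge0_le0; [apply/ltW/same_sign | rewrite subr_le0].
  (* A positive product would put the intact link [e] in [SU], with [l] as witness. *)
  rewrite subr0; apply: mulr_le0_ge0 => //; rewrite leNgt; apply/negP => de.
  have : e \in SU E r VH F theta' U.
    by rewrite inE in_setD eF eU; apply/existsP; exists l; rewrite lUF.
  by rewrite SU0 inE.
have /andP[D_ge_neg D_le_pos] := sum_change_bounds p' UH delta_bnd.
rewrite -/D in D_ge_neg D_le_pos.
move: fU_lt; rewrite -/(d l) /fUg; case: ifPn => [/existsP[k /andP[kUF dk]]|].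
  (* The witness [k] need not be [l]; condition 1 carries its sign over. Dividing [D_le] by [d l]
     then gives [D] at least [(1 - x l) * |d l|], which exceeds the upper bound on [D]. *)
  have dl : d l < 0 by rewrite -(nmulr_rgt0 _ dk); apply: same_sign.
  rewrite ltr0_norm //; move: D_le; rewrite ler_nM2l //; nra.
move=> /existsPn/(_ l); rewrite lUF /= -leNgt -/(d l) => dl0.
(* The positive square excludes [d l = 0]. The same division now bounds [D] from above, against its
   lower bound. *)
have dl : 0 < d l by move: dl2; rewrite -expr2 exprn_even_gt0 //= lt_def dl0 andbT.
rewrite gtr0_norm //; move: D_le; rewrite ler_pM2l //; nra.
Qed.
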